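(* It holds that $$\max_{x\in\mathcal{X}}\min_{y\in\mathcal{Y}(x)}L^+(x,y)\ \le\ z^{\circ}\ \le\ \max_{x\in\mathcal{X}}\min_{y\in\mathcal{Y}(x)}\bigl\{1-F^+(x,y)\bigr\},$$ where $z^\circ:=\max_{x\in\mathcal{X}}L^+(x,y^* )$ with $y^*\in\operatorname{argmax}_{y\in\mathcal{Y}(x)}F^+(x,y)$. In addition, $$\max_{x\in\mathcal{X}}\min_{y\in\mathcal{Y}(x)}L^+(x,y)=\max_{x\in\mathcal{X}}\min_{y\in\mathcal{Y}}\sum_{i\in I}h_i\left(\frac{U_i^L+\sum_{j\in J}w_{ij}x_j}{U_i^L+U_i^F+\sum_{j\in J}w_{ij}(x_j\vee y_j)+U_i^{\circ}}\right)$$ and $$\max_{x\in\mathcal{X}}\min_{y\in\mathcal{Y}(x)}\bigl\{1-F^+(x,y)\bigr\}=\max_{x\in\mathcal{X}}\min_{y\in\mathcal{Y}}\sum_{i\in I}h_i\left(\frac{U_i^L+\sum_{j\in J}w_{ij}x_j+U_i^{\circ}}{U_i^L+U_i^F+\sum_{j\in J}w_{ij}(x_j\vee y_j)+U_i^{\circ}}\right).$$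
   Context: Setting: leader (L), follower (F) and outside competitors. $I$ is a finite nonempty set of customer nodes; $J$ (candidate sites), $J^L$ and $J^F$ (pre-existing facilities of leader and follower) are finite pairwise disjoint sets. Demand weights $h_i\ge 0$ satisfy $\sum_{i\in I}h_i=1$. With real $\alpha_j$, distances $d_{ij}\ge0$ and $\beta>0$, set $w_{ij}:=\exp\{\alpha_j-\beta d_{ij}\}>0$ for $i\in I$, $j\in J\cup J^L\cup J^F$, and $U_i^L:=\sum_{j\in J^L}w_{ij}\ge 0$, $U_i^F:=\sum_{j\in J^F}w_{ij}\ge 0$. $U_i^{\circ}>0$ is the utility of the outside options for customers at $i$. The budgets $p,r$ are nonnegative integers with $p+r\le|J|$; $\mathcal{X}:=\{x\in\{0,1\}^{|J|}:\sum_jx_j\le p\}$, $\mathcal{Y}:=\{y\in\{0,1\}^{|J|}:\sum_jy_j\le r\}$, $\mathcal{Y}(x):=\{y\in\mathcal{Y}:y_j\le1-x_j\ \forall j\in J\}$. Notation: $a\vee b:=\max\{a,b\}$. The leader's and follower's market shares are $$L^+(x,y)=\sum_{i\in I}h_i\,\frac{U_i^L+\sum_{j\in J}w_{ij}x_j}{U_i^L+U_i^F+\sum_{j\in J}w_{ij}(x_j+y_j)+U_i^{\circ}},\qquad F^+(x,y)=\sum_{i\in I}h_i\,\frac{U_i^F+\sum_{j\in J}w_{ij}y_j}{U_i^L+U_i^F+\sum_{j\in J}w_{ij}(x_j+y_j)+U_i^{\circ}}.$$ In the definition of $z^\circ$, for each $x$ the vector $y^*=y^*(x)$ is any (arbitrarily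 selected) maximizer of $F^+(x,\cdot)$ over $\mathcal{Y}(x)$; the claim is for any such selection. *)

(* Defs.v *)
From HB Require Import structures.
From mathcomp Require Import all_boot all_order all_algebra.
From mathcomp Require Import reals sequences exp.

Set Implicit Arguments.
Unset Strict Implicit.
Unset Printing Implicit Defensive.

Import Order.TTheory GRing.Theory Num.Theory.
Local Open Scope ring_scope.

(* Maximum and minimum of f over the finite set A.  The element t0 must belong
   to A: it only serves as a starting value for the iteration; see maxoverP and
   minoverP. *)
Definition maxover (R : realType) (T : finType) (A : {set T}) (t0 : T)
  (f : T -> R) : R := \big[Num.max/f t0]_(t in A) f t.

Definition minover (R : realType) (T : finType) (A : {set T}) (t0 : T)
  (f : T -> R) : R := \big[Num.min/f t0]_(t in A) f t.

Lemma maxoverP (R : realType) (T : finType) (A : {set T}) (t0 : T)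
    (f : T -> R) : t0 \in A ->
  (exists2 t, t \in A & f t = maxover A t0 f) /\
  (forall t, t \in A -> f t <= maxover A t0 f).
Proof.
move=> t0A; split; last by move=> t tA; rewrite /maxover (bigD1 t) //= le_max lexx.
rewrite /maxover; elim/big_ind: _ => [|u v [s sA <-] [t tA <-]|t tA].
- by exists t0.
- by case: (leP (f s) (f t)) => _; [exists t | exists s].
- by exists t.
Qed.

Lemma minoverP (R : realType) (T : finType) (A : {set T}) (t0 : T)
    (f : T -> R) : t0 \in A ->
  (exists2 t, t \in A & f t = minover A t0 f) /\
  (forall t, t \in A -> minover A t0 f <= f t).
Proof.
move=> t0A; split; last by move=> t tA; rewrite /minover (bigD1 t) //= ge_min lexx.
rewrite /minover; elim/big_ind: _ => [|u v [s sA <-] [t tA <-]|t tA].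
- by exists t0.
- by case: (leP (f s) (f t)) => _; [exists s | exists t].
- by exists t.
Qed.

Definition argmax (R : realType) (T : finType) (A : {set T}) (f : T -> R) :
  {set T} := [set t in A | [forall s in A, f s <= f t]].

(* 0-1 vectors indexed by J, with true = 1 and false = 0. *)
Definition binvec (J : finType) : finType := {ffun J -> bool}.

Definition zerov (J : finType) : binvec J := [ffun=> false].

(* The sets of candidate sites J, leader facilities JL and follower facilities
   JF are pairwise disjoint, so locations range over the disjoint sum. *)
Record market (R : realType) (I J JL JF : finType) := Market {
  demand : I -> R;
  attract : J + JL + JF -> R;
  dist : I -> J + JL + JF -> R;
  sensitivity : R;
  outside : I -> R;
  budgetL : nat;
  budgetF : nat
}.

Section Model.
Variables (R : realType) (I J JL JF : finType) (M : market R I J JL JF).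

Definition weight (i : I) (j : J + JL + JF) : R :=
  expR (attract M j - sensitivity M * dist M i j).

Definition w (i : I) (j : J) : R := weight i (inl (inl j)).

Definition UL (i : I) : R := \sum_(j : JL) weight i (inl (inr j)).

Definition UF (i : I) : R := \sum_(j : JF) weight i (inr j).

Definition X : {set binvec J} :=
  [set x : binvec J | (\sum_(j : J) x j <= budgetL M)%N].

Definition Y : {set binvec J} :=
  [set y : binvec J | (\sum_(j : J) y j <= budgetF M)%N].

Definition Yx (x : binvec J) : {set binvec J} :=
  [set y in Y | [forall j, (y j <= 1 - x j)%N]].

Lemma zerov_X : zerov J \in X.
Proof. by rewrite inE big1 // => j _; rewrite ffunE. Qed.

Lemma zerov_Y : zerov J \in Y.
Proof. by rewrite inE big1 // => j _; rewrite ffunE. Qed.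

Lemma zerov_Yx (x : binvec J) : zerov J \in Yx x.
Proof. by rewrite inE zerov_Y; apply/forallP => j; rewrite ffunE. Qed.

Definition Lplus (x y : binvec J) : R :=
  \sum_(i : I) demand M i *
    ((UL i + \sum_(j : J) w i j * (x j)%:R) /
     (UL i + UF i + \sum_(j : J) w i j * ((x j)%:R + (y j)%:R) + outside M i)).

Definition Fplus (x y : binvec J) : R :=
  \sum_(i : I) demand M i *
    ((UF i + \sum_(j : J) w i j * (y j)%:R) /
     (UL i + UF i + \sum_(j : J) w i j * ((x j)%:R + (y j)%:R) + outside M i)).

Definition maxX (f : binvec J -> R) : R := maxover X (zerov J) f.

Definition minY (f : binvec J -> R) : R := minover Y (zerov J) f.

Definition minYx (x : binvec J) (f : binvec J -> R) : R :=
  minover (Yx x) (zerov J) f.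

Definition zcirc (ystar : binvec J -> binvec J) : R :=
  maxX (fun x => Lplus x (ystar x)).

End Model.

(* Main.v *)
(* On Yx x the supports of x and y are disjoint, so x + y = x \/ y.  Conversely,
   deleting from y \in Y the sites already taken by x gives an element of Yx x
   with the same x \/ y.  Hence the minima agree for each x.  The
   bounds on zcirc follow from Lplus <= 1 - Fplus, the gap being the share of the
   outside options. *)
Require Import Defs.
From HB Require Import structures.
From mathcomp Require Import all_boot all_order all_algebra.
From mathcomp Require Import reals sequences exp.
From mathcomp Require Import ring.

Set Implicit Arguments.
Unset Strict Implicit.
Unset Printing Implicit Defensive.

Import Order.TTheory GRing.Theory Num.Theory.
Local Open Scope ring_scope.

Lemma max_bool (R : realType) (a b : bool) :
  Num.max a%:R b%:R = (a || b)%:R :> R.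
Proof. by case: a; case: b; rewrite /Order.max ?ltxx ?ltr01 ?ltr10. Qed.

Lemma maxover_le (R : realType) (T : finType) (A : {set T}) (t0 : T)
    (f g : T -> R) : t0 \in A -> {in A, forall t, f t <= g t} ->
  maxover A t0 f <= maxover A t0 g.
Proof.
move=> t0A fg; have [[t tA <-] _] := maxoverP f t0A.
by apply: (le_trans (fg t tA)); have [_ ->] := maxoverP g t0A.
Qed.

Lemma eq_maxover (R : realType) (T : finType) (A : {set T}) (t0 : T)
    (f g : T -> R) : f =1 g -> maxover A t0 f = maxover A t0 g.
Proof. by move=> fg; rewrite /maxover fg; apply: eq_bigr => t _. Qed.

(** Both functions take the same set of values, so a minimizer on either side is matched by a point
    of the other set with equal value. This allows minima over different feasible sets to be
    compared. *)
Lemma eq_minover_image (R : realType) (T : finType) (A B : {set T}) (s0 t0 : T)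
    (f g : T -> R) : s0 \in A -> t0 \in B ->
  {in A, forall s, exists2 t, t \in B & g t = f s} ->
  {in B, forall t, exists2 s, s \in A & f s = g t} ->
  minover A s0 f = minover B t0 g.
Proof.
move=> s0A t0B AB BA.
have [[s sA <-] fmin] := minoverP f s0A.
have [[t tB <-] gmin] := minoverP g t0B.
have [t' t'B gt'] := AB s sA; have [s' s'A fs'] := BA t tB.
by apply/le_anti; rewrite -{1}fs' -{2}gt' fmin // gmin.
Qed.

Section Market.
Variables (R : realType) (I J JL JF : finType) (M : market R I J JL JF).
Hypothesis outside_gt0 : forall i : I, 0 < outside M i.

Lemma w_ge0 i j : 0 <= w M i j.
Proof. exact: expR_ge0. Qed.

Lemma denominator_gt0 i (x y : binvec J) :
  0 < UL M i + UF M i + \sum_(j : J) w M i j * ((x j)%:R + (y j)%:R)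
      + outside M i.
Proof.
apply: ltr_wpDl => //; rewrite !addr_ge0 //; apply: sumr_ge0 => j _;
  rewrite ?expR_ge0 //.
by rewrite mulr_ge0 ?w_ge0 ?addr_ge0 ?ler0n.
Qed.

(** Since the demands sum to 1, the constant 1 is the demand-weighted sum of each denominator over
    itself, and the follower's numerators are subtracted termwise. *)
Lemma one_sub_Fplus (x y : binvec J) : \sum_(i : I) demand M i = 1 ->
  1 - Fplus M x y = \sum_(i : I) demand M i *
    ((UL M i + \sum_(j : J) w M i j * (x j)%:R + outside M i) /
     (UL M i + UF M i + \sum_(j : J) w M i j * ((x j)%:R + (y j)%:R)
      + outside M i)).
Proof.
move=> demand_sum1; rewrite -[X in X - _]demand_sum1 /Fplus -sumrB; apply: eq_bigr => i _.
have dgt0 := denominator_gt0 i x y.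
rewrite -[X in X - _]mulr1 -mulrBr; congr (_ * _).
rewrite -[X in X - _](divff (lt0r_neq0 dgt0)) -mulrBl; congr (_ / _).
(* Separating the [x] and [y] parts of the denominator lets the follower's terms cancel. *)
under eq_bigr do rewrite mulrDr.
rewrite big_split /=; ring.
Qed.

Lemma Lplus_le_one_sub_Fplus (x y : binvec J) :
  (forall i, 0 <= demand M i) -> \sum_(i : I) demand M i = 1 ->
  Lplus M x y <= 1 - Fplus M x y.
Proof.
move=> demand_ge0 demand_sum1; rewrite one_sub_Fplus //.
apply: ler_sum => i _; apply: ler_wpM2l => //.
by rewrite ler_pM2r ?invr_gt0 ?denominator_gt0 // lerDl ltW.
Qed.

(** An abstract [F] of the occupancy vector covers both share formulas at once; pointwise invariance
    of [F] stands in for functional extensionality. *)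
Lemma minYx_join (x : binvec J) (F : (J -> R) -> R) :
  (forall a b, a =1 b -> F a = F b) ->
  minYx M x (fun y => F (fun j => (x j)%:R + (y j)%:R)) =
  minY M (fun y => F (fun j => Num.max (x j)%:R (y j)%:R)).
Proof.
move=> Fext; apply: eq_minover_image; rewrite ?zerov_Yx ?zerov_Y //.
- move=> y; rewrite inE => /andP[yY /forallP yx]; exists y => //.
  apply: Fext => j; move: (yx j).
  (* The constraint [yx] excludes the one case, both true, where sum and maximum differ. *)
  by case: (x j); case: (y j) => // _; rewrite ?addr0 ?add0r max_bool.
- move=> y yY; exists [ffun j => y j && ~~ x j].
    rewrite !inE; apply/andP; split; last first.
      by apply/forallP => j; rewrite ffunE; case: (x j); case: (y j).
    move: yY; rewrite inE; apply: leq_trans; apply: leq_sum => j _.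
    by rewrite ffunE; case: (x j); case: (y j).
  apply: Fext => j; rewrite ffunE.
  by case: (x j); case: (y j); rewrite ?addr0 ?add0r max_bool.
Qed.

End Market.

Theorem proposition8 (R : realType) (I J JL JF : finType)
    (M : market R I J JL JF)
    (I_nonempty : (0 < #|I|)%N)
    (demand_ge0 : forall i : I, 0 <= demand M i)
    (demand_sum1 : \sum_(i : I) demand M i = 1)
    (dist_ge0 : forall (i : I) (j : J + JL + JF), 0 <= dist M i j)
    (sensitivity_gt0 : 0 < sensitivity M)
    (outside_gt0 : forall i : I, 0 < outside M i)
    (budgets : (budgetL M + budgetF M <= #|J|)%N) :
  (forall ystar : binvec J -> binvec J,
     (forall x : binvec J, x \in X M ->
        ystar x \in argmax (Yx M x) (Fplus M x)) ->
     maxX M (fun x => minYx M x (fun y => Lplus M x y)) <= zcirc M ystar /\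
     zcirc M ystar <= maxX M (fun x => minYx M x (fun y => 1 - Fplus M x y)))
  /\
  maxX M (fun x => minYx M x (fun y => Lplus M x y)) =
  maxX M (fun x => minY M (fun y =>
    \sum_(i : I) demand M i *
      ((UL M i + \sum_(j : J) w M i j * (x j)%:R) /
       (UL M i + UF M i
        + \sum_(j : J) w M i j * Num.max (x j)%:R (y j)%:R
        + outside M i))))
  /\
  maxX M (fun x => minYx M x (fun y => 1 - Fplus M x y)) =
  maxX M (fun x => minY M (fun y =>
    \sum_(i : I) demand M i *
      ((UL M i + \sum_(j : J) w M i j * (x j)%:R + outside M i) /
       (UL M i + UF M i
        + \sum_(j : J) w M i j * Num.max (x j)%:R (y j)%:R
        + outside M i)))).
Proof.
(* The numerator [N] is left free so that this serves as the invariance hypothesis of [minYx_join]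
   with and without the outside utility in the numerator. *)
have eq_share (N : I -> R) (a b : J -> R) : a =1 b ->
    \sum_(i : I) demand M i *
      (N i / (UL M i + UF M i + \sum_(j : J) w M i j * a j + outside M i)) =
    \sum_(i : I) demand M i *
      (N i / (UL M i + UF M i + \sum_(j : J) w M i j * b j + outside M i)).
  move=> ab; apply: eq_bigr => i _.
  by under eq_bigr do rewrite ab.
split; last split.
- move=> ystar ystarP; split; apply: maxover_le; rewrite ?zerov_X // => x xX;
    have := ystarP x xX; rewrite inE => /andP[yYx /forallP ymax].
  + by have [_ ->] := minoverP (fun y => Lplus M x y) (zerov_Yx M x).
  (* A minimizer [y] of [1 - Fplus] is compared with [ystar x], whose optimality gives
     [Fplus M x y <= Fplus M x (ystar x)]. *)
  + rewrite /minYx; have [[y yx <-] _] := minoverP (fun y => 1 - Fplus M x y) (zerov_Yx M x).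
    apply: (le_trans (Lplus_le_one_sub_Fplus _ _ _ demand_ge0 demand_sum1)) => //.
    by rewrite lerD2l lerN2; exact: implyP (ymax y) yx.
- apply: eq_maxover => x; exact: minYx_join (eq_share _).
- apply: eq_maxover => x; rewrite -(minYx_join _ _ (eq_share _)).
  (* The starting value of the iterated minimum also contains [1 - Fplus] and is rewritten
     separately from the terms. *)
  rewrite /minYx /minover one_sub_Fplus //.
  by apply: eq_bigr => y _; rewrite one_sub_Fplus.
Qed.
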